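(* Assume the Continuum Hypothesis (CH). Then there exists a scattered space $X$ such that $\mathbf{OF}(X)$ is order isomorphic to $(\omega+1,\geq)$, i.e. to the ordinal $\omega+1$ endowed with the reversed order.
   Context: All topological spaces are assumed to be Hausdorff and infinite. A space is scattered if each of its nonempty subspaces contains an isolated point. Filters are proper. A filter $\mathcal F$ on a space $X$ is open if it has a base consisting of open sets, and free if every $x\in X$ has an open neighborhood $U$ with $X\setminus U\in\mathcal F$. $\mathbf{OF}(X)$ is the poset of all free open filters on $X$, ordered by inclusion. *)

(* Defs.v *)
From HB Require Import structures.
From mathcomp Require Import all_boot all_order.
From mathcomp Require Import boolp classical_sets cardinality filter topology.
Set Implicit Arguments.
Unset Strict Implicit.
Unset Printing Implicit Defensive.

Local Open Scope classical_set_scope.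
Local Open Scope card_scope.

Definition continuum_hypothesis : Prop :=
  forall A : set (set nat), countable A \/ A #= [set: set nat].

Definition scattered (X : topologicalType) : Prop :=
  forall A : set X, A !=set0 -> isolated A !=set0.

Definition open_filter (X : topologicalType) (F : set_system X) : Prop :=
  exists2 B : set_system X, B `<=` open & F = filter_from B id.

Definition free_filter (X : topologicalType) (F : set_system X) : Prop :=
  forall x : X, exists2 U : set X, open_nbhs x U & F (~` U).

Definition free_open_filters (X : topologicalType) : set (set_system X) :=
  [set F | [/\ ProperFilter F, open_filter F & free_filter F]].

Definition OF (X : topologicalType) : Type := set_type (@free_open_filters X).

HB.instance Definition _ (X : topologicalType) :=
  SubChoice.on (OF X).
HB.instance Definition _ (X : topologicalType) :=
  Order.SubChoice_isSubPOrder.Build _ (set (set X)) _ set_display (OF X).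

Lemma le_OFE (X : topologicalType) (F G : OF X) :
  (F <= G)%O = `[< val F `<=` val G >].
Proof. by []. Qed.

(* The ordinal omega + 1: [Some n] is the finite ordinal n and [None] is the
   top element omega. *)
Definition omega_plus_one : Type := option nat.

Definition le_omega_plus_one (a b : omega_plus_one) : bool :=
  match a, b with
  | _, None => true
  | None, Some _ => false
  | Some m, Some n => (m <= n)%N
  end.

Fact le_omega_plus_one_refl : reflexive le_omega_plus_one.
Proof. by case=> [n|] //=. Qed.

Fact le_omega_plus_one_anti : antisymmetric le_omega_plus_one.
Proof. by move=> [m|] [n|] //= /anti_leq ->. Qed.

Fact le_omega_plus_one_trans : transitive le_omega_plus_one.
Proof. by move=> [n|] [m|] [p|] //=; exact: leq_trans. Qed.

Fact le_omega_plus_one_total : total le_omega_plus_one.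
Proof. by move=> [m|] [n|] //=; exact: leq_total. Qed.

Fact omega_plus_one_display : Order.disp_t. Proof. by []. Qed.

HB.instance Definition _ := Choice.copy omega_plus_one (option nat).
HB.instance Definition _ :=
  Order.Le_isPOrder.Build omega_plus_one_display omega_plus_one
    le_omega_plus_one_refl le_omega_plus_one_anti le_omega_plus_one_trans.
HB.instance Definition _ :=
  Order.POrder_isTotal.Build omega_plus_one_display omega_plus_one
    le_omega_plus_one_total.

Lemma le_omega_plus_oneE (a b : omega_plus_one) :
  (a <= b)%O = le_omega_plus_one a b.
Proof. by []. Qed.

Definition order_isomorphic (d d' : Order.disp_t)
    (P : porderType d) (Q : porderType d') : Prop :=
  exists f : P -> Q, bijective f /\ {mono f : x y / (x <= y)%O}.

(* Main.v *)
(* Let D be the set of finite sequences of naturals and v a free ultrafilter on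
   nat.  The map fiblim A = {x | i :: x is in A for v-almost all i} is a Boolean
   endomorphism of P(D) that kills singletons and sends the preimage of A under
   behead back to A.  Give Z = nat * D the topology in which W is open iff each layer
   satisfies W_(n+1) <= fiblim W_n: it is scattered, and (n, x) is the
   limit of the ultrafilter {A | x in fiblim^n A} on D = Z_0.

   Under CH a tower of length omega_1 yields an ultrafilter u on D such that
   fiblim^n A is nonempty for A in u, and every sequence C_n in u admits A in u
   with fiblim^n A <= fiblim^n (C_n) for all n.  Let u_n be the image of u under
   [drop n].  The layers of an open set W satisfy W_(n+1) in u_(n+1) -> W_n in
   u_n, so the open sets near the ideal point defined by the u_n are, up to the
   filter F_omega = {W | W_i in u_i for all i}, only the unions Z_0 + ... + Z_n
   and Z itself; this gives the chain of filters
   F_n = {W | W_i in u_i for all i <= n} and their intersection F_omega.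

   It remains to make every other open filter converge.  For this one adds a
   second copy of D (the principal ultrafilters) and all free ultrafilters q on
   D: each q is a limit of q on the second copy and, when q neither is u nor
   converges in Z, also of q on Z_0.  Every open filter meeting the second copy
   then has a cluster point, so a free open filter lives on Z with trace u on Z_0,
   and the choice of u forces it to contain F_omega. *)
From HB Require Import structures.
From mathcomp Require Import wochoice.
Require Import Defs.
From mathcomp Require Import all_boot all_order.
From mathcomp Require Import boolp classical_sets cardinality filter topology.
Import Order.TTheory.
Set Implicit Arguments.
Unset Strict Implicit.
Unset Printing Implicit Defensive.

Local Open Scope classical_set_scope.

(** * Ultrafilters on a set *)

Lemma ultra_setC (T : Type) (q : set_system T) (A : set T) :
  UltraFilter q -> q A -> ~ q (~` A).
Proof.
move=> qU qA qnA; apply: (@filter_not_empty _ q).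
by rewrite -(setICr A); exact: filterI.
Qed.

Lemma ultra_neqP (T : Type) (q r : set_system T) :
  UltraFilter q -> UltraFilter r -> q <> r -> exists2 A, q A & ~ r A.
Proof.
move=> qU rU qr; apply: contrapT => qNr; apply: qr; apply/esym/max_filter.
by move=> A qA; apply: contrapT => rA; apply: qNr; exists A.
Qed.

Lemma proper_ultra (T : Type) (F : set_system T) :
  ProperFilter F -> (forall A, F A \/ F (~` A)) -> UltraFilter F.
Proof.
move=> FF FC; split=> // G GF FG; rewrite eqEsubset; split=> // A GA.
have [//|/FG GnA] := FC A.
have : G (A `&` ~` A) by exact: filterI.
by rewrite setICr => /filter_not_empty.
Qed.

(** * The limit operator [fiblim] and its iterates *)

Definition free_ultrafilter : set_system nat :=
  sval (cid (ultraFilterLemma eventually_filter)).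

#[local] Instance free_ultrafilter_ultra : UltraFilter free_ultrafilter.
Proof. by rewrite /free_ultrafilter; case: cid => q []. Qed.

Lemma free_ultrafilterN1 k : ~ free_ultrafilter [set k].
Proof.
have sub : \oo `<=` free_ultrafilter.
  by rewrite /free_ultrafilter; case: cid => q [].
move=> /ultra_setC; apply; apply: sub.
by exists k.+1 => // n /= kn nk; rewrite nk ltnn in kn.
Qed.

Definition fiblim (A : set (seq nat)) : set (seq nat) :=
  [set x | free_ultrafilter [set i | A (i :: x)]].

Lemma fiblim_subset A B : A `<=` B -> fiblim A `<=` fiblim B.
Proof. by move=> AB x; apply: filterS => i; exact: AB. Qed.

Lemma fiblimI A B : fiblim (A `&` B) = fiblim A `&` fiblim B.
Proof.
rewrite eqEsubset; split; last by move=> x [Ax Bx]; exact: filterI.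
by move=> x ABx; split; apply: fiblim_subset ABx => y [].
Qed.

Lemma fiblimC A : fiblim (~` A) = ~` fiblim A.
Proof.
rewrite eqEsubset; split=> x.
  by move=> nAx /ultra_setC; exact.
by have [|] := in_ultra_setVsetC [set i | A (i :: x)] free_ultrafilter_ultra.
Qed.

Lemma fiblimT : fiblim setT = setT.
Proof. by rewrite -subTset => x _; exact: filterT. Qed.

(** Since [drop n.+1 (i :: x) = drop n x], the condition on [i] is constant. *)
Lemma fiblim_drop n A : fiblim (drop n.+1 @^-1` A) = drop n @^-1` A.
Proof.
rewrite eqEsubset; split=> x /=; rewrite /fiblim /=; last first.
  by move=> Ax; apply: filterE.
by move=> /filter_ex[].
Qed.

Lemma fiblim1 x : fiblim [set x] = set0.
Proof.
rewrite -subset0 => y xy; case: x xy => [|k x] xy.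
  by have /filter_ex[i] := xy.
by apply: (@free_ultrafilterN1 k); apply: filterS xy => i [].
Qed.

Local Notation ilim n := (iter n fiblim).

Lemma ilim_subset n A B : A `<=` B -> ilim n A `<=` ilim n B.
Proof. by move=> AB; elim: n => //= n; exact: fiblim_subset. Qed.

Lemma ilimI n A B : ilim n (A `&` B) = ilim n A `&` ilim n B.
Proof. by elim: n => //= n ->; rewrite fiblimI. Qed.

Lemma ilimC n A : ilim n (~` A) = ~` ilim n A.
Proof. by elim: n => //= n ->; rewrite fiblimC. Qed.

Lemma ilimU n A B : ilim n (A `|` B) = ilim n A `|` ilim n B.
Proof.
by apply: setC_inj; rewrite -ilimC !setCU ilimI !ilimC.
Qed.

Lemma ilimT n : ilim n setT = setT.
Proof. by elim: n => //= n ->; rewrite fiblimT. Qed.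

Lemma ilim0 n : ilim n set0 = set0.
Proof. by rewrite -setCT ilimC ilimT setCT. Qed.

Lemma ilim_drop n A : ilim n (drop n @^-1` A) = A.
Proof.
elim: n A => [|n IHn] A /=; first by rewrite eqEsubset; split=> x; rewrite /= drop0.
by rewrite -iterS iterSr fiblim_drop IHn.
Qed.

(** The [m]-th limit of the fibre is the singleton of [x], which the next [fiblim] kills. *)
Lemma ilim_drop1 m n x : m < n -> ilim n (drop m @^-1` [set x]) = set0.
Proof.
by move=> mn; rewrite -(subnK mn) iterD iterS ilim_drop fiblim1 ilim0.
Qed.

Lemma ilim_neq0 n m A : n <= m -> ilim m A !=set0 -> ilim n A !=set0.
Proof.
move=> nm; rewrite -(subnK nm) iterD => -[x Ax].
apply: contrapT => /set0P/negP; rewrite negbK => /eqP A0.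
by move: Ax; rewrite A0 ilim0.
Qed.

(** * Positive sets and fusion *)

(* The fibre of [drop m] over [::]; these sets generate the ideal modulo which
   the tower of positive sets is decreasing. *)
Definition short m : set (seq nat) := [set a | size a <= m].

Lemma short_le m n : m <= n -> short m `<=` short n.
Proof. by move=> mn a /leq_trans; exact. Qed.

(** Discarding each [short m] makes positivity pass upward along [almost_sub]. *)
Definition positive (A : set (seq nat)) :=
  forall m n, ilim n (A `\` short m) !=set0.

Definition almost_sub (A B : set (seq nat)) := exists m, A `\` B `<=` short m.

Lemma sub_almost_sub A B : A `<=` B -> almost_sub A B.
Proof. by move=> AB; exists 0 => x [/AB]. Qed.

Lemma almost_sub_trans B A C : almost_sub A B -> almost_sub B C -> almost_sub A C.
Proof.
move=> [m AB] [n BC]; exists (maxn m n) => x [Ax nCx].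
have [Bx|nBx] := pselect (B x).
  by apply: (short_le (leq_maxr m n)); exact: BC.
by apply: (short_le (leq_maxl m n)); exact: AB.
Qed.

Lemma almost_subI A B C : almost_sub A B -> almost_sub A C -> almost_sub A (B `&` C).
Proof.
move=> [m AB] [n AC]; exists (maxn m n) => x [Ax].
rewrite -[~ _]/((~` _) x) setCI => -[nBx|nCx].
  by apply: (short_le (leq_maxl m n)); exact: AB.
by apply: (short_le (leq_maxr m n)); exact: AC.
Qed.

Lemma positive_almost_sub A B : almost_sub A B -> positive A -> positive B.
Proof.
move=> [k AB] pA m n; have [x Ax] := pA (maxn k m) n; exists x.
apply: ilim_subset Ax => a [Aa nsa]; split.
  apply: contrapT => nBa; apply: nsa; apply: (short_le (leq_maxl k m)).
  exact: AB.
by move=> sa; apply: nsa; apply: short_le sa; exact: leq_maxr.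
Qed.

Lemma positiveT : positive setT.
Proof.
(* A sequence with this tail after [n] entries has length [n + m + 1], too long for [short m]. *)
move=> m n; exists (nseq m.+1 0).
apply: (@ilim_subset n (drop n @^-1` [set nseq m.+1 0])); last first.
  by rewrite ilim_drop.
move=> a /(congr1 size); rewrite size_drop size_nseq => an.
by split=> //; apply/negP; rewrite -ltnNge -an leq_subr.
Qed.

(** Non-positive sets form an ideal: an empty limit stays empty at higher levels and for larger
    [short m], so two failures combine at the maxima. *)
Lemma positive_split A B : positive A -> positive (A `&` B) \/ positive (A `\` B).
Proof.
move=> pA; apply: contrapT => /not_orP[].
move=> /existsNP[m1] /existsNP[n1] /set0P/negP; rewrite negbK => /eqP e1.
move=> /existsNP[m2] /existsNP[n2] /set0P/negP; rewrite negbK => /eqP e2.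
have := pA (maxn m1 m2) (maxn n1 n2).
have -> : A `\` short (maxn m1 m2) =
    (A `&` B `\` short (maxn m1 m2)) `|` (A `\` B `\` short (maxn m1 m2)).
  by rewrite -setDUl setUIDK.
rewrite ilimU => -[x [] H].
  have [] := @ilim_neq0 n1 _ (A `&` B `\` short m1) (leq_maxl n1 n2).
    exists x; apply: ilim_subset H => a [ABa nsa]; split=> // sa; apply: nsa.
    by apply: short_le sa; exact: leq_maxl.
  by rewrite e1.
have [] := @ilim_neq0 n2 _ (A `\` B `\` short m2) (leq_maxr n1 n2).
  exists x; apply: ilim_subset H => a [ABa nsa]; split=> // sa; apply: nsa.
  by apply: short_le sa; exact: leq_maxr.
by rewrite e2.
Qed.

(* The n-th piece of A is the part of C n above a single point of level n, hence
   is invisible to [ilim k] for k > n; this is why only C n constrains [ilim n A]. *)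
Lemma positive_fusion (C : nat -> set (seq nat)) :
  (forall t, C t.+1 `<=` C t) -> (forall t, positive (C t)) ->
  exists A, [/\ positive A, A `<=` C 0, forall t, almost_sub A (C t) &
                forall n, ilim n A `<=` ilim n (C n)].
Proof.
move=> Cdec pC.
have Cle s t : s <= t -> C t `<=` C s.
  move=> st; rewrite -(subnK st); elim: (t - s) => //= k IH.
  by rewrite addSn; apply: subset_trans (Cdec _) IH.
pose z t := sval (cid (pC t t t)).
have zP t : ilim t (C t `\` short t) (z t) by rewrite /z; case: cid.
pose P t := (C t `\` short t) `&` drop t @^-1` [set z t].
have Pz t : ilim t (P t) (z t) by rewrite ilimI ilim_drop; split => //; exact: zP.
pose Q n := \bigcup_(t < n) P t.
have QS n : Q n.+1 = Q n `|` P n.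
  rewrite /Q eqEsubset; split=> [a [t /= tn Pa]|a [[t /= tn Pa]|Pa]].
  - move: tn; rewrite ltnS leq_eqVlt => /orP[/eqP <-|tn]; first by right.
    by left; exists t.
  - by exists t => //=; apply: ltnW.
  - by exists n => /=.
have sub n : \bigcup_t P t `<=` C n `|` Q n.
  move=> a [t _ Pa]; have [nt|tn] := leqP n t.
    by left; apply: Cle nt _ _; case: Pa => -[].
  by right; exists t.
have P0 t n : t < n -> ilim n (P t) = set0.
  move=> tn; rewrite -subset0 -[X in _ `<=` X](ilim_drop1 (z t) tn).
  by apply: ilim_subset => a [].
exists (\bigcup_t P t); split.
(* The piece at level [maxn m n] avoids [short m], and its nonempty limit there forces one at level
   [n]. *)
- move=> m n; apply: (@ilim_neq0 _ (maxn m n)); first exact: leq_maxr.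
  exists (z (maxn m n)); apply: ilim_subset (Pz _) => a Pa.
  split; first by exists (maxn m n).
  move=> sa; case: Pa => -[_ + _]; apply; apply: short_le sa; exact: leq_maxl.
- by move=> a [t _ [[/(Cle _ _ (leq0n t))]]].
(* Members of [P t] have length at most [t + size (z t)], so finitely many pieces fit in one
   [short m]. *)
- move=> t; suff [m Qm] : exists m, Q t `<=` short m.
    by exists m => a [/(sub t)[]// Qa _]; exact: Qm.
  elim: t => [|t [m Qm]]; first by exists 0 => a [t].
  exists (maxn m (t + size (z t))); rewrite QS => a [/Qm|[_ /= <-]].
    by apply: short_le; exact: leq_maxl.
  by apply: (short_le (leq_maxr _ _)); rewrite /short /= size_drop -leq_subLR.
- move=> n x Ax.
  have : ilim n (C n `|` Q n) x by exact: ilim_subset (sub n) _ Ax.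
  rewrite ilimU => -[//|].
  suff H k : k <= n -> ilim n (Q k) = set0 by rewrite H.
  elim: k => [_|k IH kn]; first by rewrite /Q bigcup_mkord big_ord0 ilim0.
  by rewrite QS ilimU IH ?P0 ?setU0 // ltnW.
Qed.
(** Enumerate [I] by an injection into [nat]. Each finite intersection [C t] almost contains the
    least of the sets involved, hence is positive, and fusion of the [C t] gives [A]. *)
Lemma countable_tower_bound (T : Type) (I : set T) (a : T -> set (seq nat)) :
  countable I -> (forall x, I x -> positive (a x)) ->
  (forall x y, I x -> I y -> almost_sub (a x) (a y) \/ almost_sub (a y) (a x)) ->
  exists2 A, positive A & forall x, I x -> almost_sub A (a x).
Proof.
move=> /countable_injP[f finj] apos acmp.
have {}finj x y : I x -> I y -> f x = f y -> x = y.
  by move=> Ix Iy; apply: finj; rewrite inE.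
pose C t := [set s | forall x, I x -> f x <= t -> a x s].
have Cx t x : I x -> f x = t.+1 -> C t.+1 = C t `&` a x.
  move=> Ix fx; rewrite eqEsubset; split=> [s Cs|s [Cs ax]].
    by split=> [y Iy fy|]; apply: Cs => //; [exact: leqW|rewrite fx].
  move=> y Iy; rewrite leq_eqVlt => /orP[/eqP fy|/Cs]; last exact.
  by rewrite (finj y x) // fy.
have Cmin t : C t = setT \/ exists2 x, I x & almost_sub (a x) (C t).
  elim: t => [|t IH].
    have [[x Ix fx]|nx] := pselect (exists2 x, I x & f x = 0).
      right; exists x => //; apply: sub_almost_sub => s ax y Iy.
      by rewrite leqn0 => /eqP fy; rewrite (finj y x) // fy.
    left; rewrite -subTset => s _ x Ix; rewrite leqn0 => /eqP fx.
    by case: nx; exists x.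
  have [[x Ix fx]|nx] := pselect (exists2 x, I x & f x = t.+1).
    right; rewrite (Cx t x) //; case: IH => [->|[y Iy yC]].
      by exists x => //; rewrite setTI; apply: sub_almost_sub.
    have [xy|yx] := acmp _ _ Ix Iy.
      exists x => //; apply: almost_subI; first exact: almost_sub_trans yC.
      exact: sub_almost_sub.
    by exists y => //; exact: almost_subI.
  suff -> : C t.+1 = C t by [].
  rewrite eqEsubset; split=> s Cs x Ix fx; apply: Cs => //; first exact: leqW.
  move: fx; rewrite leq_eqVlt => /orP[/eqP fx|//].
  by case: nx; exists x.
have [|t|A [Apos _ AC _]] := @positive_fusion C.
- by move=> t s Cs x Ix fx; apply: Cs => //; exact: leqW.
- case: (Cmin t) => [->|[x Ix xC]]; first exact: positiveT.
  exact: positive_almost_sub xC (apos x Ix).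
exists A => // x Ix; apply: almost_sub_trans (AC (f x)) _.
by apply: sub_almost_sub => s; apply.
Qed.

(** * Towers under CH and the generic ultrafilter *)

(** If a well-order of [set nat] has an uncountable initial segment, take the least one: by CH it is
    equipotent to [set nat], and its order is pulled back along a bijection. *)
Lemma CH_order : continuum_hypothesis ->
  exists lt : set nat -> set nat -> Prop,
    [/\ well_founded lt, forall x y, [\/ lt x y, x = y | lt y x] &
        forall x, countable [set y | lt y x]].
Proof.
move=> CH; have [R Rwo] := well_ordering_principle (set nat).
pose lt x y := R x y && (x != y).
have wf : well_founded lt.
  move=> x; apply: contrapT => nx.
  have [|y [[]]] := Rwo [pred y | `[< ~ Acc lt y >]].
    by exists x; apply/asboolP.
  move=> /asboolP ny ymin _; apply: ny; constructor=> z /andP[Rzy zy].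
  apply: contrapT => nz; move: zy.
  have Ryz : R y z by apply: ymin; apply/asboolP.
  have /wo_chain_antisymmetric : wo_chain R predT by apply: withinW.
  by move=> /(_ z y) -> //; rewrite ?eqxx // Rzy Ryz.
have tot x y : [\/ lt x y, x = y | lt y x].
  have /wo_chainW/(_ x y isT isT) : wo_chain R predT by apply: withinW.
  rewrite /lt; have [->|xy] := eqVneq x y; first by move=> _; apply: Or32.
  by move=> /orP[->|->]; [apply: Or31|apply: Or33].
have [ctbl|/existsNP[x0]] := pselect (forall x, countable [set y | lt y x]).
  by exists lt.
elim/(well_founded_ind wf): x0 => x0 IH nx0.
have [[y yx0 ny]|ymin] := pselect (exists2 y, lt y x0 & ~ countable [set z | lt z y]).
  exact: IH y yx0 ny.
have [//|] := CH [set y | lt y x0].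
rewrite card_eq_sym => /card_bijP[g [h gK hK]].
pose g' (x : set nat) : set nat := val (g (exist _ x (mem_setT x))).
exists (fun x y => lt (g' x) (g' y)).
have ginj x y : g' x = g' y -> x = y.
  move=> /val_inj/(can_inj gK) e.
  by have /= := congr1 val e.
have gx0 x : lt (g' x) x0 by exact: set_mem (valP (g (exist _ x (mem_setT x)))).
split.
- suff H z x : g' x = z -> Acc (fun x y => lt (g' x) (g' y)) x by move=> x; exact: H.
  elim/(well_founded_ind wf): z x => z IHz x zx.
  by constructor=> y yx; apply: (IHz (g' y)) => //; rewrite -zx.
- move=> x y; have [lxy|/ginj exy|lyx] := tot (g' x) (g' y).
  + exact: Or31. + exact: Or32. + exact: Or33.
- move=> x; apply: (@sub_countable _ _ _ [set z | lt z (g' x)]).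
    exact: (@card_ge_preimage _ _ [set z | lt z (g' x)] g' (in2W ginj)).
  by apply: contrapT => nc; apply: ymin; exists (g' x).
Qed.

Lemma positive_tower (T : Type) (lt : T -> T -> Prop) (P : T -> set (set (seq nat))) :
  well_founded lt -> (forall x y, [\/ lt x y, x = y | lt y x]) ->
  (forall x, countable [set y | lt y x]) ->
  (forall x A, positive A -> exists B, [/\ positive B, B `<=` A & P x B]) ->
  exists a : T -> set (seq nat), [/\ forall x, positive (a x),
    forall x y, lt y x -> almost_sub (a x) (a y) & forall x, P x (a x)].
Proof.
move=> wf tot ctbl step.
pose good x (rec : forall y, lt y x -> set (seq nat)) :=
  [set A | [/\ positive A, forall y (yx : lt y x), almost_sub A (rec y yx) & P x A]].
(* Choice by [xget] has the default [set0]; the induction below shows that a good set exists at each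
   stage. *)
pose a := Fix wf (fun=> set (seq nat)) (fun x rec => xget set0 (good x rec)).
have aE x : a x = xget set0 (good x (fun y _ => a y)).
  rewrite /a Fix_eq // => {}x f g fg; congr xget.
  suff -> : f = g by [].
  apply: functional_extensionality_dep => y.
  by apply: functional_extensionality_dep => yx.
suff aP x : good x (fun y _ => a y) (a x).
  by exists a; split=> [x|x y yx|x]; have [? H ?] := aP x => //; exact: H.
elim/(well_founded_ind wf): x => x IH.
have [|y z yx zx|A Apos Aa] := @countable_tower_bound T [set y | lt y x] a (ctbl x).
- by move=> y /IH[].
- have [yz|->|zy] := tot y z.
  + by right; have [_ H _] := IH z zx; exact: H.
  + by left; exact: sub_almost_sub.
  + by left; have [_ H _] := IH y yx; exact: H.
have [B [Bpos BA PB]] := step x A Apos.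
rewrite aE; case: xgetP => [B' _ //|/(_ B)[]].
split=> // y yx; apply: almost_sub_trans (Aa y yx).
exact: sub_almost_sub.
Qed.

(** One dichotomy for two purposes: a constant [C] decides whether a set or its complement enters
    the ultrafilter, and when all [C n] lie in it the second case is impossible, leaving the fusion
    property. *)
Definition decides (C : nat -> set (seq nat)) : set (set (seq nat)) :=
  [set A | (forall n, ilim n A `<=` ilim n (\bigcap_(i < n.+1) C i)) \/
           exists t, A `&` \bigcap_(i < t.+1) C i = set0].

(** If all finite intersections stay positive within [A], fuse them; otherwise [positive_split]
    allows removing one of them from [A]. *)
Lemma positive_decides C A : positive A ->
  exists B, [/\ positive B, B `<=` A & decides C B].
Proof.
move=> pA; pose D t := A `&` \bigcap_(i < t.+1) C i.
have [pD|/existsNP[t npD]] := pselect (forall t, positive (D t)).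
  have [t s [As Cs]|//|B [pB BD _ BC]] := @positive_fusion D.
    by split=> // i /= it; apply: Cs; exact: leqW.
  exists B; split=> //; first by move=> s /BD[].
  by left=> n s /BC; apply: ilim_subset => a [].
have [//|pAD] := positive_split (\bigcap_(i < t.+1) C i) pA.
exists (A `\` \bigcap_(i < t.+1) C i); split; [exact: pAD|by move=> s []|].
by right; exists t; rewrite setDE -setIA setICl setI0.
Qed.

Lemma generic_ultrafilter : continuum_hypothesis ->
  exists u : set_system (seq nat),
    [/\ UltraFilter u, forall A n, u A -> ilim n A !=set0 &
        forall C, (forall n, u (C n)) ->
          exists2 A, u A & forall n, ilim n A `<=` ilim n (C n)].
Proof.
move=> /CH_order[lt [wf tot ctbl]].
(* Sequences of subsets of the countable set [seq nat] are coded by sets of naturals, so the tower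
   indexed by [set nat] meets every [C]. *)
pose code (S : set nat) (t : nat) : set (seq nat) := [set a | S (pickle (t, a))].
have codeP C : exists S, code S = C.
  exists [set k | if unpickle k is Some (t, a) then C t a else False].
  by apply/funext => t; rewrite eqEsubset; split=> s; rewrite /code /= pickleK.
have [a [apos adec aP]] := positive_tower wf tot ctbl
  (fun S => @positive_decides (code S)).
pose u := [set B | exists S m, a S `\` short m `<=` B].
have upos B : u B -> positive B.
  by move=> [S [m aB]]; apply: positive_almost_sub (apos S); exists m => s [aSs nB];
  apply: contrapT => ns; apply: nB; exact: aB.
have aSu S : u (a S) by exists S, 0 => s [].
have uF : ProperFilter u.
  split; first by move=> /upos/(_ 0 0)[s []].
  split=> [|A B [S [m SA]] [S' [m' SB]]|A B AB [S [m SA]]].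
  - by exists set0, 0.
  - have H S1 m1 S2 m2 : almost_sub (a S1) (a S2) ->
        exists m, a S1 `\` short m `<=` (a S1 `\` short m1) `&` (a S2 `\` short m2).
      move=> [k ak]; exists (maxn k (maxn m1 m2)) => s [as1 ns]; split; split=> //.
      + by move=> sm; apply: ns; apply: short_le sm; rewrite !leq_max leqnn orbT.
      + apply: contrapT => nas; apply: ns; apply: short_le (ak s _) => //.
        exact: leq_maxl.
      + by move=> sm; apply: ns; apply: short_le sm; rewrite !leq_max leqnn !orbT.
    have [|] : almost_sub (a S) (a S') \/ almost_sub (a S') (a S).
      have [l|->|l] := tot S S'; [right|left|left]; first exact: adec.
        exact: sub_almost_sub.
      exact: adec.
      move=> /(H _ m _ m')[k Hk]; exists S, k => s /Hk[/SA As /SB Bs]; exact.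
    move=> /(H _ m' _ m)[k Hk]; exists S', k => s /Hk[/SB Bs /SA As]; exact.
  - by exists S, m; exact: subset_trans AB.
exists u; split.
- apply: proper_ultra => B; have [S SB] := codeP (fun=> B).
  have := aP S; rewrite /decides /= SB.
  have capB t : \bigcap_(i < t.+1) B = B.
    by rewrite eqEsubset; split=> s; [move=> /(_ 0); exact|move=> Bs i].
  move=> [/(_ 0) /=|[t]]; rewrite capB => H.
    by left; exact: filterS (aSu S).
  by right; apply: filterS (aSu S); apply/disjoints_subset.
- by move=> A n /upos/(_ 0 n)[x Ax]; exists x; apply: ilim_subset Ax => s [].
- move=> C uC; have [S SC] := codeP C; have := aP S; rewrite /decides /= SC.
  case=> [aC|[t at0]].
    by exists (a S) => // n x /aC; apply: ilim_subset => s; apply=> /=.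
  have uCt k : u (\bigcap_(i < k) C i).
    elim: k => [|k IH]; first by rewrite bigcap_mkord big_ord0; exact: filterT.
    by rewrite bigcap_mkord big_ord_recr /= -bigcap_mkord; exact: filterI.
  have : u set0 by rewrite -at0; apply: filterI.
  by move=> /filter_not_empty.
Qed.

(** * Ultrafilters as points *)

Definition point_trace (z : nat * seq nat) : set_system (seq nat) :=
  [set A | ilim z.1 A z.2].

Lemma point_trace_ultra z : UltraFilter (point_trace z).
Proof.
apply: proper_ultra => [|A]; last first.
  by rewrite /point_trace /= ilimC; exact: EM.
split; first by rewrite /point_trace /= ilim0.
split=> [|A B|A B AB]; rewrite /point_trace /=.
- by rewrite ilimT.
- by rewrite ilimI.
- exact: ilim_subset.
Qed.

(** The fibre of [drop n] over [x] separates: its [n]-th limit is the singleton of [x], and its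
    higher limits are empty. *)
Lemma point_trace_inj : injective point_trace.
Proof.
move=> [n x] [m y] e.
wlog nm : n m x y e / n <= m.
  by move=> H; have [nm|/ltnW mn] := leqP n m; [exact: H|by apply/esym/H].
have : point_trace (n, x) (drop n @^-1` [set x]) by rewrite /point_trace /= ilim_drop.
rewrite e /point_trace /=; move: nm; rewrite leq_eqVlt => /orP[/eqP <-|nm].
  by rewrite ilim_drop => ->.
by rewrite ilim_drop1.
Qed.

Definition ultrafilters := {q : set_system (seq nat) | UltraFilter q}.

#[local] Instance ultrafilters_ultra (q : ultrafilters) : UltraFilter (sval q).
Proof. exact: svalP q. Qed.

Lemma ultrafilters_inj (q r : ultrafilters) : sval q = sval r -> q = r.
Proof. by case: q r => [q qU] [r rU] /= qr; exact: eq_exist. Qed.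

Definition principal (d : seq nat) : ultrafilters :=
  exist _ (principal_filter d) (principal_filter_ultra d).

Lemma principalE d A : sval (principal d) A = A d.
Proof. by apply/propext; exact: principal_filterP. Qed.

Lemma point_trace0 d : point_trace (0, d) = sval (principal d).
Proof. by apply/funext => A; rewrite principalE. Qed.

(** The principal ultrafilters in the right summand serve as the second copy of [seq nat]. The type
    carries [u] so that a topology depending on [u] can be attached to it. *)
Definition omega_space (u : set_system (seq nat)) : Type :=
  (nat * seq nat + ultrafilters)%type.

(** * The topology, scatteredness and separation *)

Section OmegaSpace.
Variable u : set_system (seq nat).

HB.instance Definition _ := gen_eqMixin (omega_space u).
HB.instance Definition _ := gen_choiceMixin (omega_space u).

Local Notation X := (omega_space u).
Implicit Types (W : set X) (q r : ultrafilters) (A B : set (seq nat)).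

Definition layer W n : set (seq nat) := [set x | W (inl (n, x))].
Definition rim W : set (seq nat) := [set d | W (inr (principal d))].

(* The ultrafilters on the bottom layer with no limit in [nat * seq nat] other than
   the one, [u], that must remain free. *)
Definition remote q := ~ (sval q = u \/ exists z, sval q = point_trace z).

Definition omega_open : set_system X :=
  [set W | [/\ forall n, layer W n.+1 `<=` fiblim (layer W n),
               forall q, W (inr q) -> sval q (rim W) &
               forall q, W (inr q) -> remote q -> sval q (layer W 0)]].

Lemma omega_openT : omega_open setT.
Proof.
split=> [n x _|q _|q _ _]; first by apply: filterE.
  by by apply: filterE.
by by apply: filterE.
Qed.

Lemma omega_openI : setI_closed omega_open.
Proof.
move=> V W [V1 V2 V3] [W1 W2 W3].
split=> [n x [/V1 Vx /W1 Wx]|q [Vq Wq]|q [Vq Wq] qr].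
- exact: filterI.
- by apply: filterI; [exact: V2|exact: W2].
- by apply: filterI; [exact: V3|exact: W3].
Qed.

Lemma omega_open_bigU (I : Type) (f : I -> set X) :
  (forall i, omega_open (f i)) -> omega_open (\bigcup_i f i).
Proof.
move=> fo; split=> [n x [i _ fx]|q [i _ fq]|q [i _ fq] qr].
- have [f1 _ _] := fo i; apply: fiblim_subset (f1 n x fx) => y fy.
  by exists i.
- have [_ f2 _] := fo i; apply: filterS (f2 q fq) => y fy.
  by exists i.
- have [_ _ f3] := fo i; apply: filterS (f3 q fq qr) => y fy.
  by exists i.
Qed.

HB.instance Definition _ := isOpenTopological.Build X
  omega_openT omega_openI omega_open_bigU.

Lemma open_layer W n : open W -> layer W n `<=` ilim n (layer W 0).
Proof.
case=> W1 _ _; elim: n => [//|n IH]; apply: subset_trans (W1 n) _.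
exact: fiblim_subset.
Qed.

(** By [open_layer], the largest open subset of the left summand with bottom layer [A]. *)
Definition cone A : set X :=
  [set w | if w is inl (n, x) then ilim n A x else False].

Lemma open_cone A : open (cone A).
Proof. by split=> [n x|q|q] //=; exact. Qed.

(** Basic neighbourhoods of the point [q]; for [q] not remote, [A] may be empty. *)
Definition spray q A B : set X :=
  [set w | match w with
           | inl (n, d) => n = 0 /\ A d
           | inr r => r = q \/ exists2 d, B d & r = principal d
           end].

Lemma open_spray q A B : sval q B -> (remote q -> sval q A) -> open (spray q A B).
Proof.
move=> qB qA; split=> [n x []//|r rq|r rq rr].
- have Brim : B `<=` rim (spray q A B) by move=> d Bd; right; exists d.
  case: rq => [->|[d Bd ->]]; first exact: filterS qB.
  by rewrite principalE; exact: Brim.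
(* A principal point is not remote, being the trace of a point of level 0. *)
- case: rq rr => [-> /qA|[d Bd ->] []]; last first.
    by right; exists (0, d); rewrite point_trace0.
  by apply: filterS.
Qed.

(** The isolated point is one of least level in the left summand, failing that a principal
    ultrafilter, failing that any point. *)
Lemma omega_scattered : scattered X.
Proof.
move=> S [s Ss].
suff [w Sw [V Vo VS]] : exists2 w, S w & exists2 V, open V & V `&` S = [set w].
  exists w; split; first exact/mem_set.
  exists V => //; apply: open_nbhs_nbhs; split=> //.
  by have [] : (V `&` S) w by rewrite VS.
have [[n [x Sx]]|S0] := pselect (exists n x, S (inl (n, x))).
  have ex : exists n, `[< exists x, S (inl (n, x)) >].
    by exists n; apply/asboolP; exists x.
  case: (ex_minnP ex) => {x Sx} m /asboolP[x Sx] mmin.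
  exists (inl (m, x)) => //.
  (* All levels below [m] together with the single point [(m, x)]. *)
  exists [set w : X | if w is inl (i, y) then i < m \/ (i, y) = (m, x) else False].
    split=> // i y [im|[im _]]; apply: filterE => k /=; left; rewrite ?im //.
    exact: ltnW.
  rewrite eqEsubset; split=> [[[i y]|q] [//= + Sy]|w ->]; last by split=> //=; right.
  case=> [im|-> //].
  have : m <= i by apply: mmin; apply/asboolP; exists y.
  by rewrite leqNgt im.
have [[d Sd]|Sp] := pselect (exists d, S (inr (principal d))).
  exists (inr (principal d)) => //; exists (spray (principal d) set0 [set d]).
    apply: open_spray; first by rewrite principalE.
    by case; right; exists (0, d); rewrite point_trace0.
  rewrite eqEsubset; split=> [[[i y]|r] [] /=|w ->].
  - by move=> [].
  - by move=> [->|[_ -> ->]].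
  - by split=> //; left.
case: s Ss => [[n x]|q] Sq; first by case: S0; exists n, x.
exists (inr q) => //; exists (spray q setT setT).
  by apply: open_spray => [|_]; exact: filterT.
rewrite eqEsubset; split=> [[[i y]|r] [] /=|w ->].
- by move=> _ Sy; case: S0; exists i, y.
- by move=> [-> //|[d _ ->] Sd]; case: Sp; exists d.
- by split=> //; left.
Qed.

Lemma omega_infinite : infinite_set [set: X].
Proof.
pose f n : X := inl (n, [::]).
have finj : {in f @^-1` setT &, injective f} by move=> m n _ _ [].
by move=> /(finite_preimage finj); rewrite preimage_setT; exact: infinite_nat.
Qed.

Lemma cone_disjoint A : cone A `&` cone (~` A) = set0.
Proof.
rewrite -subset0 => -[[n x]|q] [] //=.
by rewrite ilimC.
Qed.

Lemma spray_disjoint q r A B : q <> r -> sval q B -> sval r (~` B) ->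
  spray q A B `&` spray r (~` A) (~` B) = set0.
Proof.
move=> qr qB rB; rewrite -subset0 => -[[n x]|s] [] /=.
  by move=> [_ Ax] [_].
move=> [->|[d Bd ->]] [//|[d' nBd']].
- by move=> qd'; apply: nBd'; move: qB; rewrite qd' principalE.
- by move=> rd; move: rB; rewrite -rd principalE; exact.
- by move=> /(congr1 sval) e; apply: nBd'; rewrite -(principalE d') -e principalE.
Qed.

(** Distinct ultrafilters differ on some [A], and cones or sprays over [A] and its complement are
    disjoint. A non-remote [q] is separated from the whole left summand by a spray with empty bottom
    layer. *)
Lemma omega_hausdorff : hausdorff_space X.
Proof.
suff sep : forall x y : X, x <> y -> exists A B : set X,
    [/\ open A, open B, A x, B y & A `&` B = set0].
  rewrite open_hausdorff => a b /eqP/sep[A [B [Ao Bo Aa Bb AB]]].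
  by exists (A, B) => /=; split; rewrite ?inE // AB.
have zq z q : exists A B : set X,
    [/\ open A, open B, A (inl z), B (inr q) & A `&` B = set0].
  have [qr|qr] := pselect (remote q); last first.
    exists (cone setT), (spray q set0 setT); split.
    - exact: open_cone.
    - by apply: open_spray => //; exact: filterT.
    - by case: z => n x /=; rewrite ilimT.
    - by left.
    - by rewrite -subset0 => -[[n x]|r] [] //= _ [].
  have [|A zA qA] := ultra_neqP (point_trace_ultra z) (svalP q).
    by move=> zq; apply: qr; right; exists z.
  have {}qA : sval q (~` A) by have [] := in_ultra_setVsetC A (svalP q).
  exists (cone A), (spray q (~` A) (~` A)); split.
  - exact: open_cone.
  - exact: open_spray.
  - by case: z zA.
  - by left.
  - by rewrite -subset0 => -[[n x]|r] [] //= Ax [n0]; apply; move: Ax; rewrite n0.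
move=> [z|q] [z'|r] xy.
- have [|A zA z'A] := @ultra_neqP _ _ _ (point_trace_ultra z) (point_trace_ultra z').
    by move=> /point_trace_inj zz'; apply: xy; rewrite zz'.
  exists (cone A), (cone (~` A)); split; try exact: open_cone.
  + by case: z zA {xy}.
  + have : point_trace z' (~` A).
      by have [] := in_ultra_setVsetC A (point_trace_ultra z').
    by case: z' {z'A xy}.
  + exact: cone_disjoint.
- exact: zq.
- have [A [B [Ao Bo Az Bq AB]]] := zq z' q; exists B, A; split=> //.
  by rewrite setIC.
- have qr : q <> r by move=> e; apply: xy; rewrite e.
  have [|A qA rA] := ultra_neqP (svalP q) (svalP r).
    by move=> /ultrafilters_inj.
  have {}rA : sval r (~` A) by have [] := in_ultra_setVsetC A (svalP r).
  exists (spray q A A), (spray r (~` A) (~` A)); split.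
  + exact: open_spray.
  + exact: open_spray.
  + by left.
  + by left.
  + exact: spray_disjoint.
Qed.

End OmegaSpace.

(** * The level filters *)

Section FreeOpenFilters.
Variable u : set_system (seq nat).
Hypothesis uU : UltraFilter u.
Hypothesis u_ilim : forall A n, u A -> ilim n A !=set0.
Hypothesis u_fusion : forall C, (forall n, u (C n)) ->
  exists2 A, u A & forall n, ilim n A `<=` ilim n (C n).

Local Notation X := (omega_space u).
Implicit Types (W V : set X) (A : set (seq nat)) (o : omega_plus_one).

(** Otherwise [u] contains the meet of the preimage of [A] and that of the complement of [fiblim A],
    whose limit at level [n.+1] is empty, against [u_ilim]. *)
Lemma shadow_fiblim n A :
  u (drop n @^-1` A) -> u (drop n.+1 @^-1` fiblim A).
Proof.
move=> uA; have [//|uN] := in_ultra_setVsetC (drop n.+1 @^-1` fiblim A) uU.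
have [x] := u_ilim n.+1 (filterI uA uN).
by rewrite ilimI ilimC (ilim_drop n.+1) iterS ilim_drop => -[].
Qed.

Lemma shadow_ilim n A : u A -> u (drop n @^-1` ilim n A).
Proof.
move=> uA; elim: n => [|n IH]; last exact: shadow_fiblim.
by apply: filterS uA => s; rewrite /= drop0.
Qed.

Definition level_filter o : set_system X :=
  [set W | forall i, le_omega_plus_one (Some i) o -> u (drop i @^-1` layer W i)].

Lemma level_filter_proper o : ProperFilter (level_filter o).
Proof.
split.
  have o0 : le_omega_plus_one (Some 0) o by case: o.
  by move=> /(_ 0 o0); rewrite preimage_set0 => /filter_not_empty.
split=> [i _|V W FV FW i io|V W VW FV i io].
- by apply: filterE.
- by apply: filterI; [exact: FV|exact: FW].
- by apply: filterS (FV i io) => x; exact: VW.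
Qed.

(** The layers of the interior of the subset of the left summand with layers [C]. *)
Fixpoint hull (C : nat -> set (seq nat)) n : set (seq nat) :=
  if n is m.+1 then C n `&` fiblim (hull C m) else C 0.

Lemma level_filter_open o : open_filter (level_filter o).
Proof.
have FF := level_filter_proper o.
exists [set W | open W /\ level_filter o W]; first by move=> W [].
rewrite eqEsubset; split=> [W FW|W [V [_ FV] VW]]; last exact: filterS VW FV.
pose C i := if le_omega_plus_one (Some i) o then layer W i else set0.
pose V : set X := [set w | if w is inl (i, x) then hull C i x else False].
have CE i : le_omega_plus_one (Some i) o -> C i = layer W i by rewrite /C => ->.
have hullC i : hull C i `<=` C i by case: i => //= i x [].
exists V => /=; last first.
  move=> [[i x]|//] /= /hullC; rewrite /C.
  by case: ifP.
split; first by split=> // i x [].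
elim=> [|i IH] io.
  by apply: filterS (FW 0 io); rewrite -(CE 0 io).
have io' : le_omega_plus_one (Some i) o by apply: (le_omega_plus_one_trans _ io) => /=.
have := shadow_fiblim (IH io'); apply: filterS2 (FW _ io) => x.
by rewrite -(CE _ io).
Qed.

Lemma level_filter_free o : free_filter (level_filter o).
Proof.
have shadowC n A : u (~` A) -> u (drop n @^-1` (~` ilim n A)).
  by rewrite -ilimC; exact: shadow_ilim.
move=> [[n x]|q].
  exists (cone (drop n @^-1` [set x])).
    by split; [exact: open_cone|rewrite /cone /= ilim_drop].
  move=> i _; apply: shadowC.
  (* The fibre over [x] has empty limit at level [n.+1], so it is not in [u]. *)
  have [uA|//] := in_ultra_setVsetC (drop n @^-1` [set x]) uU.
  by have [y] := u_ilim n.+1 uA; rewrite ilim_drop1.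
have [qr|qr] := pselect (remote u q); last first.
  exists (spray q set0 setT); last by move=> i _; apply: filterE => x [].
  by split; [apply: open_spray => //; exact: filterT|left].
have [|A qA uA] := ultra_neqP (svalP q) uU; first by move=> qu; apply: qr; left.
exists (spray q A A); first by split; [exact: open_spray|left].
have {}uA : u (~` A) by have [] := in_ultra_setVsetC A uU.
move=> [|i] _; last by apply: filterE => x [].
by apply: filterS uA => x nAx; rewrite /= drop0 => -[].
Qed.

Lemma level_filter_le o o' : level_filter o `<=` level_filter o' -> (o' <= o)%O.
Proof.
rewrite le_omega_plus_oneE => oo'; apply/negPn/negP => /negP nle.
case: o oo' nle => [n|] oo' nle; last by case: o' nle {oo'}.
have no' : le_omega_plus_one (Some n.+1) o'.
  by case: o' nle {oo'} => //= m /negP; rewrite -ltnNge.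
(* The levels up to [n] form a member of [level_filter (Some n)] that is empty at level [n.+1]. *)
pose W : set X := [set w | if w is inl (i, _) then i <= n else False].
have /oo'/(_ n.+1 no') : level_filter (Some n) W by move=> i ni; apply: filterE.
have -> : drop n.+1 @^-1` layer W n.+1 = set0.
  by rewrite -subset0 => x; rewrite /layer /= ltnn.
exact: filter_not_empty.
Qed.

(** * Classification of the free open filters *)

Section FreeOpenFilter.
Variable F : set_system X.
Hypothesis (FF : ProperFilter F) (Fopen : open_filter F) (Ffree : free_filter F).

Lemma filter_openP W : F W -> exists V, [/\ open V, F V & V `<=` W].
Proof.
case: Fopen => B Bo FE; rewrite {1}FE => -[V BV VW]; exists V; split=> //.
  exact: Bo.
by rewrite FE; exists V.
Qed.

(** Compactness of the space of ultrafilters, for traces such as [rim] and the bottom layer: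
    otherwise the sets [f W] minus [A] generate a proper filter, and an ultrafilter extending it
    violates the hypothesis. *)
Lemma free_trace (f : set X -> set (seq nat)) A :
  (forall V W, V `<=` W -> f V `<=` f W) ->
  (forall V W, f V `&` f W `<=` f (V `&` W)) ->
  (forall q : ultrafilters, (forall W, F W -> sval q (f W)) -> sval q A) ->
  exists2 W, F W & f W `<=` A.
Proof.
move=> fS fI fq; apply: contrapT => nA.
pose G := filter_from F (fun W => f W `\` A).
have GF : ProperFilter G.
  apply: filter_from_proper; last first.
    move=> W FW; apply: contrapT => W0; apply: nA; exists W => // x fx.
    by apply: contrapT => nAx; apply: W0; exists x.
  apply: filter_from_filter; first by exists setT; exact: filterT.
  move=> V W FV FW; exists (V `&` W); first exact: filterI.
  by move=> x [fx nAx]; split; split=> //; apply: fS fx => y [].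
have [q [qU Gq]] := ultraFilterLemma GF.
have FWq W : F W -> q (f W `\` A) by move=> FW; apply: Gq; exists W.
have qA : q A by apply: (fq (exist _ q qU)) => W /FWq; apply: filterS => x [].
apply: (ultra_setC qU qA).
by apply: filterS (FWq setT filterT) => x [].
Qed.


(** An ultrafilter containing all rims of members of [F] would be a cluster point of [F]. *)
Lemma free_rim : exists2 W, F W & rim W = set0.
Proof.
have [|V W x []//|q qF|W FW W0] := @free_trace (@rim u) set0.
- by move=> V W VW x; exact: VW.
- have [U [[_ U2 _] Uq]] := Ffree (inr q).
  move=> /qF; have := U2 q Uq.
  by move=> qU /(filterI qU); rewrite (_ : _ `&` _ = set0) ?setICr.
- by exists W => //; rewrite -subset0.
Qed.

(** Any ultrafilter other than [u] containing all bottom layers is remote or a point trace, and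
    either way yields a cluster point of [F]. *)
Lemma free_layer0 A : u A -> exists2 W, F W & layer W 0 `<=` A.
Proof.
move=> uA; apply: free_trace => [V W VW x|V W x []//|q qF]; first exact: VW.
suff qu : sval q = u by rewrite qu.
apply: contrapT => qu.
have contra (U : set X) : F (~` U) -> sval q (layer U 0) -> False.
  move=> /qF qnU /(filterI qnU); rewrite (_ : _ `&` _ = set0) ?setICl//.
  exact: filter_not_empty.
have [qr|qr] := pselect (remote u q).
  have [U [[_ _ U3] Uq]] := Ffree (inr q).
  by move=> /contra; apply; exact: U3.
have [//|[[n x] qz]] : sval q = u \/ exists z, sval q = point_trace z.
  exact: contrapT.
have [U [Uo Ux]] := Ffree (inl (n, x)).
by move=> /contra; apply; rewrite qz; exact: open_layer Ux.
Qed.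

Lemma free_cone A : u A -> F (cone A).
Proof.
move=> uA; have [W0 FW0 W0r] := free_rim; have [W1 FW1 W1A] := free_layer0 uA.
have [V [Vo FV VW]] := filter_openP (filterI FW0 FW1).
apply: filterS FV => -[[n x]|q] Vw /=.
  have /= := open_layer Vo Vw; apply: ilim_subset => y Vy; apply: W1A.
  by have [] := VW _ Vy.
have [_ V2 _] := Vo; have := V2 q Vw.
rewrite (_ : rim V = set0); first exact: filter_not_empty.
by rewrite -subset0 -W0r => d Vd; have [] := VW _ Vd.
Qed.

(** Fusion of the preimages of the layers of [W] gives [A] in [u] whose cone lies inside [W]. *)
Lemma level_filter_min : level_filter None `<=` F.
Proof.
move=> W FW; have [|A uA AC] := u_fusion (C := fun n => drop n @^-1` layer W n).
  by move=> n; exact: FW.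
apply: filterS (free_cone uA) => -[[n x]|//] /AC.
by rewrite ilim_drop.
Qed.

(** Otherwise an open member of [F] inside [W] and the cone over the complement has empty bottom
    layer, hence is empty. *)
Lemma free_shadow0 W : F W -> u (layer W 0).
Proof.
move=> FW; have [//|uN] := in_ultra_setVsetC (layer W 0) uU.
have [V [Vo FV VW]] := filter_openP (filterI FW (free_cone uN)).
have [[[n x]|q] Vw] := filter_ex FV; last by have [_ []] := VW _ Vw.
have /= := open_layer Vo Vw; rewrite (_ : layer V 0 = set0) ?ilim0//.
by rewrite -subset0 => y /VW[].
Qed.

Lemma free_level_filter : exists o, F = level_filter o.
Proof.
(* With no bad level [F] is the least filter; otherwise the least bad level is some [m.+1], and [F]
   is the filter of level [m]. *)
pose bad n := exists V, [/\ open V, F V & ~ u (drop n @^-1` layer V n)].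
have good n : ~ bad n -> forall W, F W -> u (drop n @^-1` layer W n).
  move=> nb W /filter_openP[V [Vo FV VW]]; apply: contrapT => nW; apply: nb.
  exists V; split=> // nV; apply: nW; apply: filterS nV => x.
  exact: VW.
have [[m bm]|nb] := pselect (exists n, bad n); last first.
  exists None; rewrite eqEsubset; split; last exact: level_filter_min.
  by move=> W FW i _; apply: good => // bi; apply: nb; exists i.
have ex : exists n, `[< bad n >] by exists m; exact/asboolP.
case: (ex_minnP ex) => {bm}m {ex} /asboolP[V [Vo FV nV]] mmin.
case: m mmin nV => [|m] mmin nV.
  case: nV; apply: filterS (free_shadow0 FV) => x.
  by rewrite /= drop0.
exists (Some m); rewrite eqEsubset; split=> [W FW i im|W FW].
  apply: good => // /asboolP/mmin; rewrite leqNgt ltnS.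
  by rewrite (im : i <= m).
(* Badness of [V] persists upward: by [shadow_fiblim], if the complement of one layer is large then
   so is that of the next. *)
have nVi k : ~ u (drop (k + m.+1) @^-1` layer V (k + m.+1)).
  elim: k => [//|k IH] uV; apply: IH; rewrite addSn in uV.
  set n := k + m.+1 in uV *; apply: contrapT => nVn.
  have {}nVn : u (drop n @^-1` (~` layer V n)).
    by have [] := in_ultra_setVsetC (drop n @^-1` layer V n) uU.
  have := shadow_fiblim nVn; rewrite fiblimC => /(filterI uV) /filter_ex[x [Vx]].
  by apply; have [V1 _ _] := Vo; exact: V1.
(* [N] follows [W] up to level [m] and avoids [V] above it, so it lies in the least filter while its
   meet with [V] lies in [W]. *)
pose N : set X := [set w | if w is inl (i, x) then
  if i <= m then layer W i x else ~ layer V i x else False].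
have FN : F N.
  apply: level_filter_min => i _; have [im|mi] := leqP i m.
    by apply: filterS (FW i im) => x Wx; rewrite /layer /N /= im.
  have := nVi (i - m.+1); rewrite subnK //.
  have [//|+ _] := in_ultra_setVsetC (drop i @^-1` layer V i) uU.
  by apply: filterS => x nVx; rewrite /layer /N /= leqNgt mi.
apply: filterS (filterI FN FV) => -[[i x]|q] [] //=.
by case: ifP.
Qed.

End FreeOpenFilter.

(** * The order isomorphism and the theorem *)

Lemma OF_order_isomorphic : order_isomorphic (OF X) (omega_plus_one^d)%type.
Proof.
have Lfree o : @free_open_filters X (level_filter o).
  split; [exact: level_filter_proper|exact: level_filter_open|exact: level_filter_free].
pose g o : OF X := exist _ (level_filter o) (mem_set (Lfree o)).
have gle o o' : (g o <= g o')%O = (o' <= o)%O.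
  rewrite le_OFE; apply/asboolP/idP => [/level_filter_le //|o'o W FW i io'].
  by apply: FW; exact: le_omega_plus_one_trans io' o'o.
have gsurj (F : OF X) : exists o, g o = F.
  have [FF Fo Ffr] := set_mem (valP F).
  have [o Fo'] := free_level_filter FF Fo Ffr.
  by exists o; apply: val_inj.
pose f F := sval (cid (gsurj F)).
have fK : cancel f g by move=> F; rewrite /f; case: cid.
exists f; split; last by move=> F G; rewrite -{2}(fK F) -{2}(fK G) gle.
exists g => // o; apply/le_anti; rewrite -!gle !fK.
by rewrite lexx.
Qed.

End FreeOpenFilters.

Theorem corollary4p14 (CH : continuum_hypothesis) :
  exists X : topologicalType,
    [/\ hausdorff_space X,
        infinite_set [set: X],
        scattered X &
        order_isomorphic (OF X) (omega_plus_one^d)%type].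
Proof.
have [u [uU u_ilim u_fusion]] := generic_ultrafilter CH.
exists (omega_space u); split.
- exact: omega_hausdorff.
- exact: omega_infinite.
- exact: omega_scattered.
- exact: OF_order_isomorphic.
Qed.
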